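(* Let $H\in C^2(\mathbb{R}^2;\mathbb{R})$ be radially symmetric, $H(p)=h(|p|)$, with $$h(s)=1+\frac{A}{s^\gamma}+\frac{\tilde h(s)}{s^{\gamma+\beta}}\quad\text{for all sufficiently large } s,$$ where $A\in\mathbb{R}\setminus\{0\}$, $\gamma>1$, $\beta\ge0$ and $\tilde h\in C^2((0,+\infty);\mathbb{R})$ satisfies: if $\beta>1$, $\tilde h$ is bounded; if $\beta\in(0,1]$, $\tilde h(s)=B+o(s^{\beta-1})$ as $s\to\infty$ for some $B\in\mathbb{R}$; if $\beta=0$, $\tilde h(s)=B+o(s^{-1})$ as $s\to\infty$ for some $B\neq-A$. Assume moreover that there is $C>0$ with $|h''(s)|\le C s^{-(\gamma+1+\min\{1,\beta\})}$ for all large $s$. Then there exist infinitely many closed immersed curves of class $C^{2,\alpha}$ ($\alpha\in(0,1)$) whose curvature coincides with $H$ at every point.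
   Context: For a regular parametrization $U$ of a planar curve (identifying $\mathbb{R}^2$ with $\mathbb{C}$, $ip$ = rotation of $p$ by $\pi/2$), its curvature is $\mathcal{K}(U)=\frac{i\dot U\cdot\ddot U}{|\dot U|^3}$; ''curvature coincides with $H$'' means $\mathcal{K}(U)(t)=H(U(t))$ for all $t$. *)

(* Defs.v *)
From Stdlib Require Import Reals.
From Coquelicot Require Import Coquelicot.
Open Scope R_scope.

Definition norm2 (p : R * R) : R := sqrt (fst p ^ 2 + snd p ^ 2).

Definition C2_plane (H : R * R -> R) : Prop :=
  exists H1 H2 H11 H12 H21 H22 : R * R -> R,
    (forall a b, is_derive (fun u => H (u, b)) a (H1 (a, b))) /\
    (forall a b, is_derive (fun v => H (a, v)) b (H2 (a, b))) /\
    (forall a b, is_derive (fun u => H1 (u, b)) a (H11 (a, b))) /\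
    (forall a b, is_derive (fun v => H1 (a, v)) b (H12 (a, b))) /\
    (forall a b, is_derive (fun u => H2 (u, b)) a (H21 (a, b))) /\
    (forall a b, is_derive (fun v => H2 (a, v)) b (H22 (a, b))) /\
    (forall p, continuous H p /\ continuous H1 p /\ continuous H2 p /\
               continuous H11 p /\ continuous H12 p /\
               continuous H21 p /\ continuous H22 p).

Definition C2_pos (f : R -> R) : Prop :=
  forall s, 0 < s ->
    ex_derive f s /\ ex_derive (Derive f) s /\ continuous (Derive_n f 2) s.

Definition closed_immersed_C2alpha (alpha : R) (x y : R -> R) (T : R) : Prop :=
  0 < T /\
  (forall t, x (t + T) = x t /\ y (t + T) = y t) /\
  (forall t, ex_derive x t /\ ex_derive (Derive x) t /\
             ex_derive y t /\ ex_derive (Derive y) t) /\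
  (* second derivatives are alpha-Hölder (hence continuous) *)
  (exists L, forall t s,
      Rabs (Derive_n x 2 t - Derive_n x 2 s) <= L * Rpower (Rabs (t - s)) alpha /\
      Rabs (Derive_n y 2 t - Derive_n y 2 s) <= L * Rpower (Rabs (t - s)) alpha) /\
  (forall t, (Derive x t, Derive y t) <> (0, 0)).

(* Curvature K(U) = (i U' . U'') / |U'|^3, with i(a,b) = (-b,a). *)
Definition curvature (x y : R -> R) (t : R) : R :=
  (- Derive y t * Derive_n x 2 t + Derive x t * Derive_n y 2 t)
  / (norm2 (Derive x t, Derive y t)) ^ 3.

Definition rot (th : R) (p : R * R) : R * R :=
  (fst p * cos th - snd p * sin th, fst p * sin th + snd p * cos th).

Definition image (x y : R -> R) (p : R * R) : Prop := exists t, p = (x t, y t).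

(* Main.v *)
Require Import Defs.
From Stdlib Require Import Reals.
From Coquelicot Require Import Coquelicot.
From Stdlib Require Import ZArith Lra Lia Classical IndefiniteDescription.
Open Scope R_scope.

(* Radial symmetry gives a conserved quantity.  Let [r] be the distance to the
   origin, [psi] the angle from the position to the tangent and [G' = r h(r)];
   then [G(r) - r sin psi] is constant along curves of curvature [h(r)].  Where
   [r h(r) > 1] this determines [r = rho(psi)] as a 2 PI-periodic function, and
   the polar angle is the integral of [sin psi / (rho h(rho) - sin psi)], so no
   differential equation has to be solved.  The curve closes up as soon as the
   increment of the polar angle over one period is a rational multiple of 2 PI.
   This increment depends continuously on the perihelion [a] and tends to 0 as
   [a] tends to infinity, so such values of [a] are infinitely many.  Different
   perihelia give curves that are not congruent by a rotation. *)

(** * Calculus: slope functions, implicit differentiation, Lipschitz bounds *)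

(** Carathéodory's form of differentiability: the difference quotient, filled in with [l] at [x], is
    continuous there. Together with its converse [derive_of_slope] it reduces implicit
    differentiation to algebra. *)
Lemma derive_slope (f : R -> R) (x l : R) :
  is_derive f x l ->
  exists q : R -> R, continuous q x /\ q x = l /\
    forall y, f y - f x = q y * (y - x).
Proof.
intros Hf.
exists (fun y => if Req_EM_T y x then l else (f y - f x) / (y - x)).
split; [|split].
- apply continuity_pt_filterlim.
  apply is_derive_Reals in Hf.
  intros eps Heps. destruct (Hf eps Heps) as [d Hd].
  exists d. split. apply cond_pos.
  intros y [[_ Hy1] Hy2]. unfold dist in *; simpl in *; unfold R_dist in *.
  destruct (Req_EM_T x x) as [_|n]; [|congruence].
  destruct (Req_EM_T y x) as [e|n]. congruence.
  specialize (Hd (y - x)). replace (x + (y - x)) with y in Hd by ring.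
  apply Hd; [lra|exact Hy2].
- destruct (Req_EM_T x x); congruence.
- intros y. destruct (Req_EM_T y x) as [e|n]. subst; ring. field; lra.
Qed.

Lemma derive_of_slope (f q : R -> R) (x : R) :
  continuous q x -> (forall y, f y - f x = q y * (y - x)) ->
  is_derive f x (q x).
Proof.
intros Hq Hf. apply is_derive_Reals.
apply continuity_pt_filterlim in Hq.
intros eps Heps. destruct (Hq eps Heps) as [d [Hd0 Hd]].
exists (mkposreal d Hd0). intros e He Hed.
simpl in Hed. rewrite Hf. replace (x + e - x) with e by ring.
replace (q (x + e) * e / e) with (q (x + e)) by (field; auto).
apply (Hd (x + e)). split. split. exact I. intros E; apply He; lra.
simpl; unfold R_dist. replace (x + e - x) with e by ring. exact Hed.
Qed.

(** Subtract the relation at [t] from the one at [y] and insert the slopes [m] of [G] and [n] of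
    [w]: the increment of [rho] times [m (rho y) - w y] equals [rho t * n y * (y - t)]. By
    continuity the factor stays nonzero near [t], so dividing exhibits a slope function of [rho];
    mere continuity of [rho] at [t] is enough to start. *)
Lemma implicit_derive (G rho w : R -> R) (k t l w' : R) :
  (forall s, G (rho s) = k + rho s * w s) ->
  continuous rho t -> is_derive G (rho t) l -> is_derive w t w' ->
  l - w t <> 0 ->
  is_derive rho t (rho t * w' / (l - w t)).
Proof.
intros HG Hc Hl Hw Hn.
destruct (derive_slope _ _ _ Hl) as [m [Hm1 [Hm2 Hm3]]].
destruct (derive_slope _ _ _ Hw) as [n [Hn1 [Hn2 Hn3]]].
assert (Hd : continuous (fun s => m (rho s) - w s) t).
{ apply (continuous_minus (fun s => m (rho s)) w).
  apply (continuous_comp rho m); auto.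
  apply (ex_derive_continuous w). exists w'; exact Hw. }
assert (Hid : forall y, (rho y - rho t) * (m (rho y) - w y) = rho t * n y * (y - t)).
{ intros y. specialize (Hm3 (rho y)). specialize (Hn3 y).
  rewrite (HG y), (HG t) in Hm3. nra. }
assert (Hloc : locally t (fun s => m (rho s) - w s <> 0)).
{ apply (Hd (fun z => z <> 0)), open_neq. rewrite Hm2; exact Hn. }
apply is_derive_ext_loc with (fun s => rho t + rho t * n s * / (m (rho s) - w s) * (s - t)).
{ revert Hloc. apply filter_imp. intros y Hy.
  assert (E : rho t + rho t * n y * / (m (rho y) - w y) * (y - t) = rho y).
  { replace (rho t * n y * / (m (rho y) - w y) * (y - t)) with
      ((rho t * n y * (y - t)) * / (m (rho y) - w y)) by ring.
    rewrite <- Hid. now field. }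
  exact E. }
replace (rho t * w' / (l - w t)) with
  ((fun s => rho t * n s * / (m (rho s) - w s)) t)
  by (rewrite Hm2, Hn2; reflexivity).
apply (derive_of_slope _ (fun s => rho t * n s * / (m (rho s) - w s))).
- apply (continuous_mult (fun s => rho t * n s) (fun s => / (m (rho s) - w s))).
  apply (continuous_mult (fun _ => rho t) n). apply continuous_const. exact Hn1.
  apply (continuous_comp (fun s => m (rho s) - w s) Rinv). exact Hd.
  apply continuous_Rinv. rewrite Hm2; exact Hn.
- intros y. ring.
Qed.

Lemma lipschitz_of_derive_bounded (f f' : R -> R) (m M K : R) :
  (forall x, m <= x <= M -> is_derive f x (f' x)) ->
  (forall x, m <= x <= M -> Rabs (f' x) <= K) ->
  forall x y, m <= x <= M -> m <= y <= M -> Rabs (f x - f y) <= K * Rabs (x - y).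
Proof.
intros Hf HK x y Hx Hy.
assert (Hin : forall z, Rmin y x <= z <= Rmax y x -> m <= z <= M).
{ intros z. unfold Rmin, Rmax. destruct (Rle_dec y x); lra. }
destruct (MVT_gen f y x f') as [c [Hc ->]].
- intros z Hz. apply Hf, Hin; lra.
- intros z Hz. apply continuity_pt_filterlim, (ex_derive_continuous f).
  exists (f' z). apply Hf, Hin, Hz.
- rewrite Rabs_mult. apply Rmult_le_compat_r. apply Rabs_pos. apply HK, Hin, Hc.
Qed.

Lemma continuous_bounded (f : R -> R) (m M : R) :
  (forall x, continuous f x) ->
  exists K, 0 <= K /\ forall x, m <= x <= M -> Rabs (f x) <= K.
Proof.
intros Hf. destruct (bounded_continuity f m M) as [K HK].
intros x _; apply Hf.
exists (Rmax 0 K). split. apply Rmax_l.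
intros x Hx. apply Rle_trans with K. left; apply (HK x Hx). apply Rmax_r.
Qed.

Lemma lipschitz_on_segment (f f' : R -> R) (m M : R) :
  (forall x, is_derive f x (f' x)) -> (forall x, continuous f' x) ->
  exists K, 0 <= K /\ forall x y, m <= x <= M -> m <= y <= M ->
    Rabs (f x - f y) <= K * Rabs (x - y).
Proof.
intros Hf Hc. destruct (continuous_bounded f' m M Hc) as [K [HK0 HK]].
exists K. split. exact HK0.
apply (lipschitz_of_derive_bounded f f'); auto.
Qed.

(** * Bounded Lipschitz functions and Hölder estimates *)

(** Boundedness is included to make the class stable under products, and to get Hölder bounds for
    points that are far apart. *)
Definition bounded_lipschitz (f : R -> R) : Prop :=
  exists K, forall t s, Rabs (f t) <= K /\ Rabs (f t - f s) <= K * Rabs (t - s).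

Lemma bounded_lipschitz_plus (f g : R -> R) :
  bounded_lipschitz f -> bounded_lipschitz g ->
  bounded_lipschitz (fun t => f t + g t).
Proof.
intros [K HK] [L HL]. exists (K + L). intros t s.
destruct (HK t s), (HL t s). split.
eapply Rle_trans. apply Rabs_triang. lra.
replace (f t + g t - (f s + g s)) with ((f t - f s) + (g t - g s)) by ring.
eapply Rle_trans. apply Rabs_triang. lra.
Qed.

Lemma bounded_lipschitz_opp (f : R -> R) :
  bounded_lipschitz f -> bounded_lipschitz (fun t => - f t).
Proof.
intros [K HK]. exists K. intros t s. destruct (HK t s).
replace (- f t - - f s) with (- (f t - f s)) by ring.
rewrite !Rabs_Ropp. auto.
Qed.

Lemma bounded_lipschitz_minus (f g : R -> R) :
  bounded_lipschitz f -> bounded_lipschitz g ->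
  bounded_lipschitz (fun t => f t - g t).
Proof.
intros Hf Hg. apply (bounded_lipschitz_plus f (fun t => - g t)); auto.
now apply bounded_lipschitz_opp.
Qed.

Lemma bounded_lipschitz_mult (f g : R -> R) :
  bounded_lipschitz f -> bounded_lipschitz g ->
  bounded_lipschitz (fun t => f t * g t).
Proof.
intros [K HK] [L HL].
assert (0 <= K) by (destruct (HK 0 0); pose proof (Rabs_pos (f 0)); lra).
assert (0 <= L) by (destruct (HL 0 0); pose proof (Rabs_pos (g 0)); lra).
exists (2 * K * L + K * L). intros t s.
destruct (HK t s) as [K1 K2], (HL t s) as [L1 L2], (HK s s) as [K3 _].
pose proof (Rabs_pos (f t)); pose proof (Rabs_pos (f s)).
pose proof (Rabs_pos (g t)); pose proof (Rabs_pos (t - s)).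
pose proof (Rabs_pos (f t - f s)); pose proof (Rabs_pos (g t - g s)).
split.
- rewrite Rabs_mult. apply Rle_trans with (K * L). apply Rmult_le_compat; auto. nra.
- replace (f t * g t - f s * g s) with ((f t - f s) * g t + f s * (g t - g s)) by ring.
  eapply Rle_trans. apply Rabs_triang. rewrite !Rabs_mult.
  assert (Rabs (f t - f s) * Rabs (g t) <= (K * Rabs (t - s)) * L) by (apply Rmult_le_compat; auto).
  assert (Rabs (f s) * Rabs (g t - g s) <= K * (L * Rabs (t - s))) by (apply Rmult_le_compat; auto).
  assert (0 <= K * L * Rabs (t - s)) by (apply Rmult_le_pos; nra).
  lra.
Qed.

Lemma bounded_lipschitz_inv (f : R -> R) :
  (forall t, 1 <= f t) -> bounded_lipschitz f -> bounded_lipschitz (fun t => / f t).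
Proof.
intros H1 [K HK].
exists (Rmax 1 K). intros t s. destruct (HK t s) as [_ K2].
pose proof (H1 t) as Ht; pose proof (H1 s) as Hs.
assert (Bt : 0 < / f t <= 1).
{ split. apply Rinv_0_lt_compat; lra. rewrite <- Rinv_1. apply Rinv_le_contravar; lra. }
assert (Bs : 0 < / f s <= 1).
{ split. apply Rinv_0_lt_compat; lra. rewrite <- Rinv_1. apply Rinv_le_contravar; lra. }
split.
- rewrite Rabs_pos_eq by lra. apply Rle_trans with 1. lra. apply Rmax_l.
- replace (/ f t - / f s) with (- (f t - f s) * (/ f t * / f s)) by (field; lra).
  rewrite Rabs_mult, Rabs_Ropp, (Rabs_pos_eq (/ f t * / f s)) by nra.
  pose proof (Rabs_pos (f t - f s)). pose proof (Rabs_pos (t - s)).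
  assert (K * Rabs (t - s) <= Rmax 1 K * Rabs (t - s)) by (apply Rmult_le_compat_r; auto; apply Rmax_r).
  assert (0 <= / f t * / f s <= 1) by nra.
  nra.
Qed.

(** The values of [f] stay in a compact interval, on which the continuous [F'] is bounded. *)
Lemma bounded_lipschitz_comp (F F' f : R -> R) :
  (forall x, is_derive F x (F' x)) -> (forall x, continuous F' x) ->
  bounded_lipschitz f -> bounded_lipschitz (fun t => F (f t)).
Proof.
intros HF HF' [K HK].
assert (Hr : forall t, - K <= f t <= K) by (intros t; apply Rabs_le_between, (HK t t)).
assert (0 <= K) by (destruct (HK 0 0); pose proof (Rabs_pos (f 0)); lra).
destruct (lipschitz_on_segment F F' (-K) K HF HF') as [L [HL0 HL]].
destruct (continuous_bounded F (-K) K) as [B [HB0 HB]].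
{ intros x. apply (ex_derive_continuous F). exists (F' x); auto. }
exists (B + L * K). intros t s. split.
- specialize (HB _ (Hr t)). nra.
- apply Rle_trans with (L * Rabs (f t - f s)). apply HL; auto.
  destruct (HK t s) as [_ K2]. pose proof (Rabs_pos (t - s)).
  assert (L * Rabs (f t - f s) <= L * (K * Rabs (t - s))) by (apply Rmult_le_compat_l; auto).
  nra.
Qed.

Lemma bounded_lipschitz_of_derive (f f' : R -> R) (B L : R) :
  (forall t, is_derive f t (f' t)) ->
  (forall t, Rabs (f t) <= B) -> (forall t, Rabs (f' t) <= L) ->
  bounded_lipschitz f.
Proof.
intros Hf HB HL. exists (Rmax B L). intros t s. split.
- eapply Rle_trans. apply HB. apply Rmax_l.
- apply Rle_trans with (L * Rabs (t - s)).
  apply (lipschitz_of_derive_bounded f f' (Rmin t s) (Rmax t s)); auto.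
  split; [apply Rmin_l|apply Rmax_l]. split; [apply Rmin_r|apply Rmax_r].
  apply Rmult_le_compat_r. apply Rabs_pos. apply Rmax_r.
Qed.

(** For distances at most 1 the distance is below its power [alpha], so the Lipschitz bound
    suffices; beyond 1 the power exceeds 1 and the trivial bound [2 * K] takes over. *)
Lemma bounded_lipschitz_holder (f : R -> R) (alpha : R) :
  0 < alpha < 1 -> bounded_lipschitz f ->
  exists L, 0 <= L /\ forall t s, Rabs (f t - f s) <= L * Rpower (Rabs (t - s)) alpha.
Proof.
intros Ha [K HK].
assert (HK0 : 0 <= K) by (destruct (HK 0 0); pose proof (Rabs_pos (f 0)); lra).
exists (2 * K). split. lra. intros t s.
destruct (HK t s) as [K1 K2], (HK s s) as [K3 _].
(* Here [Rpower 0 alpha] is a positive default value rather than 0; its positivity is enough. *)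
destruct (Req_dec t s) as [E|E].
{ subst. rewrite Rminus_diag, Rabs_R0.
  apply Rmult_le_pos. lra. left; apply exp_pos. }
assert (Hp : 0 < Rabs (t - s)) by (apply Rabs_pos_lt; lra).
destruct (Rle_dec (Rabs (t - s)) 1) as [Hle|Hgt].
- assert (Rabs (t - s) <= Rpower (Rabs (t - s)) alpha).
  { rewrite <- (Rpower_1 (Rabs (t - s))) at 1 by auto.
    unfold Rpower.
    assert (ln (Rabs (t - s)) <= 0).
    { rewrite <- ln_1. destruct Hle as [Hl|He]. left; apply ln_increasing; auto. rewrite He; lra. }
    destruct (Rle_lt_or_eq_dec (1 * ln (Rabs (t - s))) (alpha * ln (Rabs (t - s)))) as [h|h]. nra.
    left; apply exp_increasing, h. rewrite h; lra. }
  nra.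
- assert (1 <= Rpower (Rabs (t - s)) alpha).
  { unfold Rpower. rewrite <- exp_0.
    assert (0 < ln (Rabs (t - s))) by (rewrite <- ln_1; apply ln_increasing; lra).
    left; apply exp_increasing. nra. }
  assert (Rabs (f t - f s) <= 2 * K).
  { unfold Rminus. eapply Rle_trans. apply Rabs_triang. rewrite Rabs_Ropp. lra. }
  nra.
Qed.

(** * Curves generated by a radial profile *)

(** The derivative in [r] of the conserved quantity [G r - r * sin t], taken at [r = rho t]. *)
Definition denominator (g rho : R -> R) (t : R) : R := rho t * g (rho t) - sin t.

Definition polar_angle (g rho : R -> R) (t : R) : R :=
  RInt (fun u => sin u / denominator g rho u) 0 t.

(** The last clause is the conservation law differentiated in [t]. The uniform bounds on [rho] and
    on the denominator keep every ingredient of the curve bounded and Lipschitz on the whole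
    line. *)
Definition radial_profile (g rho : R -> R) (m M : R) : Prop :=
  0 < m /\ (forall t, m <= rho t <= M) /\
  (forall t, 1 <= denominator g rho t) /\
  (forall t, rho (t + 2 * PI) = rho t) /\
  (forall t, is_derive rho t (rho t * cos t / denominator g rho t)).


Definition rolling_x (g rho : R -> R) (t : R) : R := rho t * cos (polar_angle g rho t).
Definition rolling_y (g rho : R -> R) (t : R) : R := rho t * sin (polar_angle g rho t).

Lemma norm2_rolling (g rho : R -> R) (t : R) :
  0 <= rho t -> norm2 (rolling_x g rho t, rolling_y g rho t) = rho t.
Proof.
intros Hr. unfold norm2, rolling_x, rolling_y; simpl fst; simpl snd.
replace (_ + _) with (rho t ^ 2 * (Rsqr (sin (polar_angle g rho t)) + Rsqr (cos (polar_angle g rho t))))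
  by (unfold Rsqr; ring).
rewrite sin2_cos2, Rmult_1_r. apply sqrt_pow2, Hr.
Qed.

Lemma denominator_derive (g g1 rho : R -> R) (m M : R) :
  (forall s, is_derive g s (g1 s)) -> radial_profile g rho m M ->
  forall t, is_derive (denominator g rho) t
    (rho t * cos t / denominator g rho t * (g (rho t) + rho t * g1 (rho t)) - cos t).
Proof.
intros Hg [_ [_ [_ [_ Hd]]]] t. unfold denominator at 1.
auto_derive.
- split; [eexists; apply Hd|split; [eexists; apply Hg|]].
  split; [eexists; apply Hd|exact I].
- rewrite (is_derive_unique (fun x : R => rho x) _ _ (Hd t)).
  rewrite (is_derive_unique (fun x : R => g x) _ _ (Hg (rho t))). ring.
Qed.

Lemma angle_rate_continuous (g g1 rho : R -> R) (m M : R) :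
  (forall s, is_derive g s (g1 s)) -> radial_profile g rho m M ->
  forall t, continuous (fun u => sin u / denominator g rho u) t.
Proof.
intros Hg Hr t.
apply (ex_derive_continuous (fun u => sin u / denominator g rho u)).
pose proof (denominator_derive _ _ _ _ _ Hg Hr t) as HD.
destruct Hr as [_ [_ [H1 _]]]. specialize (H1 t).
auto_derive. split. eexists; apply HD. split; auto. lra.
Qed.

Lemma polar_angle_derive (g g1 rho : R -> R) (m M : R) :
  (forall s, is_derive g s (g1 s)) -> radial_profile g rho m M ->
  forall t, is_derive (polar_angle g rho) t (sin t / denominator g rho t).
Proof.
intros Hg Hr t. pose proof (angle_rate_continuous _ _ _ _ _ Hg Hr) as Hc.
apply (is_derive_RInt (fun u => sin u / denominator g rho u) _ 0).
- apply filter_forall. intros y. apply (@RInt_correct R_CompleteNormedModule).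
  apply ex_RInt_continuous. intros; apply Hc.
- apply Hc.
Qed.

(** The integrand is periodic: split the integral at [2 * PI] and translate the second piece back to
    start at 0. *)
Lemma polar_angle_shift (g g1 rho : R -> R) (m M : R) :
  (forall s, is_derive g s (g1 s)) -> radial_profile g rho m M ->
  forall t, polar_angle g rho (t + 2 * PI) = polar_angle g rho t + polar_angle g rho (2 * PI).
Proof.
intros Hg Hr t. pose proof (angle_rate_continuous _ _ _ _ _ Hg Hr) as Hc.
assert (He : forall a b, ex_RInt (fun u => sin u / denominator g rho u) a b)
  by (intros a b; apply (@ex_RInt_continuous R_CompleteNormedModule); intros; apply Hc).
unfold polar_angle at 1.
rewrite <- (RInt_Chasles _ 0 (2 * PI) (t + 2 * PI)) by apply He.
change plus with Rplus. rewrite Rplus_comm. f_equal.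
pose proof (RInt_comp_lin (fun u => sin u / denominator g rho u) 1 (2 * PI) 0 t (He _ _)) as E.
replace (1 * 0 + 2 * PI) with (2 * PI) in E by ring.
replace (1 * t + 2 * PI) with (t + 2 * PI) in E by ring.
rewrite <- E. unfold polar_angle. apply RInt_ext. intros u _.
destruct Hr as [_ [_ [_ [Hp _]]]].
unfold scal; simpl; unfold mult; simpl. unfold denominator.
rewrite !Rmult_1_l, Hp, sin_plus, cos_2PI, sin_2PI. f_equal; [|f_equal]; ring.
Qed.

Lemma iterate_shift (f : R -> R) (P D : R) :
  (forall t, f (t + P) = f t + D) -> forall n t, f (t + INR n * P) = f t + INR n * D.
Proof.
intros Hf n; induction n as [|n IH]; intros t.
- simpl. rewrite !Rmult_0_l, !Rplus_0_r. reflexivity.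
- rewrite S_INR. replace (t + (INR n + 1) * P) with (t + INR n * P + P) by ring.
  rewrite Hf, IH. ring.
Qed.

(** Negative [k] are included because the polar angle may decrease over a period. *)
Lemma cos_sin_shift (k : Z) (x : R) :
  cos (x + 2 * PI * IZR k) = cos x /\ sin (x + 2 * PI * IZR k) = sin x.
Proof.
assert (E : cos (2 * PI * IZR k) = 1 /\ sin (2 * PI * IZR k) = 0).
{ assert (S : forall j : nat, cos (2 * PI * INR j) = 1 /\ sin (2 * PI * INR j) = 0).
  { intros j. replace (2 * PI * INR j) with (0 + 2 * INR j * PI) by ring.
    rewrite cos_period, sin_period, cos_0, sin_0. auto. }
  destruct (Z_le_gt_dec 0 k) as [h|h].
  - rewrite <- (Z2Nat.id k), <- INR_IZR_INZ by auto. apply S.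
  - replace (2 * PI * IZR k) with (- (2 * PI * IZR (- k))) by (rewrite opp_IZR; ring).
    rewrite <- (Z2Nat.id (- k)), <- INR_IZR_INZ by lia.
    rewrite cos_neg, sin_neg. destruct (S (Z.to_nat (- k))) as [-> ->]. split; lra. }
destruct E as [Ec Es].
rewrite cos_plus, sin_plus, Ec, Es. split; ring.
Qed.

(** The derivative of arc length with respect to the parameter, as [rolling_derive] shows. *)
Definition speed (g rho : R -> R) (t : R) : R := rho t / denominator g rho t.

(** Written with products and inverses rather than quotients, to match the closure lemmas of
    [bounded_lipschitz]. *)
Definition speed_rate (g g1 rho : R -> R) (t : R) : R :=
  (rho t * cos t -
   rho t * (rho t * cos t * / denominator g rho t * (g (rho t) + rho t * g1 (rho t)) - cos t))
  * / denominator g rho t * / denominator g rho t.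

Lemma speed_derive (g g1 rho : R -> R) (m M : R) :
  (forall s, is_derive g s (g1 s)) -> radial_profile g rho m M ->
  forall t, is_derive (speed g rho) t (speed_rate g g1 rho t).
Proof.
intros Hg Hr t. pose proof (denominator_derive _ _ _ _ _ Hg Hr t) as HD.
destruct Hr as [_ [_ [H1 [_ Hd]]]]. specialize (H1 t).
unfold speed. auto_derive.
- split. eexists; apply Hd. split. eexists; apply HD. split; auto. lra.
- rewrite (is_derive_unique (fun x : R => rho x) _ _ (Hd t)), (is_derive_unique (fun x : R => denominator g rho x) _ _ HD).
  unfold speed_rate. field. lra.
Qed.

(* The unit tangent at parameter [t] has direction [t + polar_angle t]:
   the parameter is the angle between the position and the tangent. *)
Lemma rolling_derive (g g1 rho : R -> R) (m M : R) :
  (forall s, is_derive g s (g1 s)) -> radial_profile g rho m M ->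
  forall t,
    is_derive (rolling_x g rho) t (speed g rho t * cos (t + polar_angle g rho t)) /\
    is_derive (rolling_y g rho) t (speed g rho t * sin (t + polar_angle g rho t)).
Proof.
intros Hg Hr t. pose proof (polar_angle_derive _ _ _ _ _ Hg Hr t) as Hp.
destruct Hr as [_ [_ [H1 [_ Hd]]]]. specialize (H1 t).
unfold rolling_x, rolling_y, speed. split; auto_derive.
1, 3: split; [eexists; apply Hd|split; auto; eexists; apply Hp].
all: rewrite (is_derive_unique (fun x : R => rho x) _ _ (Hd t)),
  (is_derive_unique (fun x : R => polar_angle g rho x) _ _ Hp);
  rewrite ?cos_plus, ?sin_plus; field; lra.
Qed.

(** The factor [1 + sin t * / denominator g rho t] is the rotation rate of the tangent direction. *)
Definition rolling_xx (g g1 rho : R -> R) (t : R) : R :=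
  speed_rate g g1 rho t * cos (t + polar_angle g rho t)
  - speed g rho t * (1 + sin t * / denominator g rho t) * sin (t + polar_angle g rho t).
Definition rolling_yy (g g1 rho : R -> R) (t : R) : R :=
  speed_rate g g1 rho t * sin (t + polar_angle g rho t)
  + speed g rho t * (1 + sin t * / denominator g rho t) * cos (t + polar_angle g rho t).

Lemma rolling_derive2 (g g1 rho : R -> R) (m M : R) :
  (forall s, is_derive g s (g1 s)) -> radial_profile g rho m M ->
  forall t,
    is_derive (Derive (rolling_x g rho)) t (rolling_xx g g1 rho t) /\
    is_derive (Derive (rolling_y g rho)) t (rolling_yy g g1 rho t).
Proof.
intros Hg Hr t.
pose proof (fun t => is_derive_unique _ _ _ (proj1 (rolling_derive _ _ _ _ _ Hg Hr t))) as Ex.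
pose proof (fun t => is_derive_unique _ _ _ (proj2 (rolling_derive _ _ _ _ _ Hg Hr t))) as Ey.
pose proof (polar_angle_derive _ _ _ _ _ Hg Hr t) as Hp.
pose proof (speed_derive _ _ _ _ _ Hg Hr t) as Hv.
split; [apply is_derive_ext with (1 := fun t => eq_sym (Ex t))
       |apply is_derive_ext with (1 := fun t => eq_sym (Ey t))]; auto_derive.
1, 3: split; [eexists; apply Hv|split; auto; eexists; apply Hp].
all: rewrite (is_derive_unique (fun x : R => speed g rho x) _ _ Hv),
  (is_derive_unique (fun x : R => polar_angle g rho x) _ _ Hp);
  unfold rolling_xx, rolling_yy, Rdiv; ring.
Qed.

(** Curvature is the rotation rate of the tangent divided by the speed. With [D] the denominator
    this is [(1 + sin t / D) / (rho t / D) = (D + sin t) / rho t], and [D + sin t] is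
    [rho t * g (rho t)]. *)
Lemma rolling_curvature (g g1 rho : R -> R) (m M : R) :
  (forall s, is_derive g s (g1 s)) -> radial_profile g rho m M ->
  forall t, curvature (rolling_x g rho) (rolling_y g rho) t = g (rho t).
Proof.
intros Hg Hr t.
destruct (rolling_derive _ _ _ _ _ Hg Hr t) as [Hx Hy].
destruct (rolling_derive2 _ _ _ _ _ Hg Hr t) as [Hxx Hyy].
unfold curvature.
change (Derive_n (rolling_x g rho) 2 t) with (Derive (Derive (rolling_x g rho)) t).
change (Derive_n (rolling_y g rho) 2 t) with (Derive (Derive (rolling_y g rho)) t).
rewrite (is_derive_unique _ _ _ Hx), (is_derive_unique _ _ _ Hy),
  (is_derive_unique _ _ _ Hxx), (is_derive_unique _ _ _ Hyy).
destruct Hr as [Hm [Hb [H1 _]]]. specialize (H1 t). specialize (Hb t).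
assert (Hv : 0 < speed g rho t) by (apply Rdiv_lt_0_compat; lra).
assert (E : forall v a, 0 < v -> norm2 (v * cos a, v * sin a) = v).
{ intros v a Hv'. unfold norm2; simpl fst; simpl snd.
  replace (_ + _) with (v ^ 2 * (Rsqr (sin a) + Rsqr (cos a))) by (unfold Rsqr; ring).
  rewrite sin2_cos2, Rmult_1_r. apply sqrt_pow2; lra. }
rewrite E by exact Hv. unfold rolling_xx, rolling_yy.
set (a := t + polar_angle g rho t).
transitivity ((1 + sin t * / denominator g rho t) / speed g rho t * (Rsqr (sin a) + Rsqr (cos a))).
{ unfold Rsqr. field. lra. }
rewrite sin2_cos2, Rmult_1_r.
transitivity ((denominator g rho t + sin t) / rho t).
{ unfold speed. field. lra. }
unfold denominator. field. lra.
Qed.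

(** The second derivatives are sums and products of bounded Lipschitz functions. The most delicate
    factor is [g1] along [rho], which is Lipschitz because [g2] is continuous and [rho] is
    bounded. *)
Lemma rolling_second_derivative_lipschitz (g g1 g2 rho : R -> R) (m M : R) :
  (forall s, is_derive g s (g1 s)) -> (forall s, is_derive g1 s (g2 s)) ->
  (forall s, continuous g2 s) -> radial_profile g rho m M ->
  bounded_lipschitz (rolling_xx g g1 rho) /\ bounded_lipschitz (rolling_yy g g1 rho).
Proof.
intros Hg Hg1 Hg2 Hr.
pose proof (polar_angle_derive _ _ _ _ _ Hg Hr) as Hp.
destruct Hr as [Hm [Hb [H1 [_ Hd]]]].
assert (Lsin : bounded_lipschitz sin).
{ apply bounded_lipschitz_of_derive with cos 1 1.
  intros; apply is_derive_sin. intros; apply Rabs_le, SIN_bound. intros; apply Rabs_le, COS_bound. }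
assert (Lcos : bounded_lipschitz cos).
{ apply bounded_lipschitz_of_derive with (fun t => - sin t) 1 1.
  intros; apply is_derive_cos. intros; apply Rabs_le, COS_bound. intros; rewrite Rabs_Ropp; apply Rabs_le, SIN_bound. }
assert (Hi : forall t, Rabs (/ denominator g rho t) <= 1).
{ intros t. specialize (H1 t). rewrite Rabs_inv, Rabs_pos_eq by lra.
  rewrite <- Rinv_1. apply Rinv_le_contravar; lra. }
assert (Lrho : bounded_lipschitz rho).
{ apply bounded_lipschitz_of_derive with (fun t => rho t * cos t / denominator g rho t) M M.
  exact Hd. intros t; specialize (Hb t); apply Rabs_le; lra.
  intros t. unfold Rdiv. rewrite !Rabs_mult.
  assert (Rabs (cos t) <= 1) by (apply Rabs_le, COS_bound).
  specialize (Hb t). specialize (Hi t). rewrite (Rabs_pos_eq (rho t)) by lra.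
  pose proof (Rabs_pos (cos t)). pose proof (Rabs_pos (/ denominator g rho t)).
  assert (Rabs (cos t) * Rabs (/ denominator g rho t) <= 1) by nra.
  assert (0 <= Rabs (cos t) * Rabs (/ denominator g rho t)) by nra.
  rewrite Rmult_assoc. nra. }
assert (Lg : bounded_lipschitz (fun t => g (rho t))).
{ apply bounded_lipschitz_comp with g1; auto.
  intros x; apply (ex_derive_continuous g1); eexists; apply Hg1. }
assert (Lg1 : bounded_lipschitz (fun t => g1 (rho t)))
  by (apply bounded_lipschitz_comp with g2; auto).
assert (LD : bounded_lipschitz (denominator g rho)).
{ apply bounded_lipschitz_minus; auto. apply bounded_lipschitz_mult; auto. }
assert (Li : bounded_lipschitz (fun t => / denominator g rho t))
  by (apply bounded_lipschitz_inv; auto).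
assert (Lv : bounded_lipschitz (speed g rho)) by (apply bounded_lipschitz_mult; auto).
assert (Hq : forall t, Rabs (1 + sin t / denominator g rho t) <= 2).
{ intros t. eapply Rle_trans. apply Rabs_triang. rewrite Rabs_R1.
  assert (Rabs (sin t) <= 1) by (apply Rabs_le, SIN_bound).
  unfold Rdiv. rewrite Rabs_mult. specialize (Hi t).
  pose proof (Rabs_pos (sin t)). nra. }
(* The tangent angle itself may be unbounded, so its sine and cosine are treated through the bound 2
   on its derivative. *)
assert (Hpd : forall t, is_derive (fun t => t + polar_angle g rho t) t (1 + sin t / denominator g rho t)).
{ intros t. apply (is_derive_plus (fun t => t) (polar_angle g rho)). apply is_derive_Reals, derivable_pt_lim_id. apply Hp. }
assert (Ls : bounded_lipschitz (fun t => sin (t + polar_angle g rho t))).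
{ apply bounded_lipschitz_of_derive with
    (fun t => (1 + sin t / denominator g rho t) * cos (t + polar_angle g rho t)) 1 2.
  - intros t. apply (is_derive_comp sin (fun t => t + polar_angle g rho t)); auto. apply is_derive_sin.
  - intros t. apply Rabs_le, SIN_bound.
  - intros t. rewrite Rabs_mult. specialize (Hq t).
    assert (Rabs (cos (t + polar_angle g rho t)) <= 1) by (apply Rabs_le, COS_bound).
    pose proof (Rabs_pos (1 + sin t / denominator g rho t)). nra. }
assert (Lc : bounded_lipschitz (fun t => cos (t + polar_angle g rho t))).
{ apply bounded_lipschitz_of_derive with
    (fun t => (1 + sin t / denominator g rho t) * - sin (t + polar_angle g rho t)) 1 2.
  - intros t. apply (is_derive_comp cos (fun t => t + polar_angle g rho t)); auto. apply is_derive_cos.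
  - intros t. apply Rabs_le, COS_bound.
  - intros t. rewrite Rabs_mult, Rabs_Ropp. specialize (Hq t).
    assert (Rabs (sin (t + polar_angle g rho t)) <= 1) by (apply Rabs_le, SIN_bound).
    pose proof (Rabs_pos (1 + sin t / denominator g rho t)). nra. }
assert (L1 : bounded_lipschitz (fun _ => 1)).
{ exists 1. intros t s. rewrite Rminus_diag, Rabs_R0, Rabs_R1.
  pose proof (Rabs_pos (t - s)). lra. }
split; unfold rolling_xx, rolling_yy, speed_rate;
repeat first [assumption | apply bounded_lipschitz_minus | apply bounded_lipschitz_plus
  | apply bounded_lipschitz_mult].
Qed.

(** After [q] periods [rho] is back to its value and the polar angle has gained [k] full turns, so
    the position repeats. The curve is immersed because its velocity is a positive multiple of a
    unit vector. *)
Lemma rolling_closed (g g1 g2 rho : R -> R) (m M alpha : R) (k : Z) (q : nat) :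
  (forall s, is_derive g s (g1 s)) -> (forall s, is_derive g1 s (g2 s)) ->
  (forall s, continuous g2 s) -> radial_profile g rho m M ->
  0 < alpha < 1 -> (0 < q)%nat ->
  INR q * polar_angle g rho (2 * PI) = 2 * PI * IZR k ->
  closed_immersed_C2alpha alpha (rolling_x g rho) (rolling_y g rho) (INR q * (2 * PI)).
Proof.
intros Hg Hg1 Hg2 Hr Ha Hq Hk.
pose proof PI_RGT_0.
pose proof (rolling_derive _ _ _ _ _ Hg Hr) as H'.
pose proof (rolling_derive2 _ _ _ _ _ Hg Hr) as H''.
assert (0 < INR q) by (apply lt_0_INR; lia).
split; [nra|split; [|split; [|split]]].
- intros t. unfold rolling_x, rolling_y.
  rewrite (iterate_shift _ _ _ (polar_angle_shift _ _ _ _ _ Hg Hr)), Hk.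
  assert (E : rho (t + INR q * (2 * PI)) = rho t).
  { rewrite (iterate_shift rho (2 * PI) 0). ring.
    intros s. rewrite Rplus_0_r. apply Hr. }
  rewrite E. destruct (cos_sin_shift k (polar_angle g rho t)) as [-> ->]. auto.
- intros t. destruct (H' t), (H'' t). repeat split; eexists; eassumption.
- destruct (rolling_second_derivative_lipschitz _ _ _ _ _ _ Hg Hg1 Hg2 Hr) as [Lx Ly].
  destruct (bounded_lipschitz_holder _ alpha Ha Lx) as [K [HK0 HK]].
  destruct (bounded_lipschitz_holder _ alpha Ha Ly) as [L [HL0 HL]].
  assert (Ex : forall t, Derive_n (rolling_x g rho) 2 t = rolling_xx g g1 rho t)
    by (intros t; apply (is_derive_unique _ _ _ (proj1 (H'' t)))).
  assert (Ey : forall t, Derive_n (rolling_y g rho) 2 t = rolling_yy g g1 rho t)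
    by (intros t; apply (is_derive_unique _ _ _ (proj2 (H'' t)))).
  exists (K + L). intros t s. rewrite !Ex, !Ey.
  assert (0 < Rpower (Rabs (t - s)) alpha) by apply exp_pos.
  specialize (HK t s). specialize (HL t s). split; nra.
- intros t E. destruct (H' t) as [Hx Hy].
  rewrite (is_derive_unique _ _ _ Hx), (is_derive_unique _ _ _ Hy) in E.
  injection E as E1 E2.
  destruct Hr as [Hm [Hb [H1 _]]]. specialize (H1 t). specialize (Hb t).
  assert (Hv : 0 < speed g rho t) by (apply Rdiv_lt_0_compat; lra).
  pose proof (sin2_cos2 (t + polar_angle g rho t)) as S. unfold Rsqr in S.
  apply Rmult_integral in E1. apply Rmult_integral in E2.
  destruct E1 as [E1|E1]; [lra|]. destruct E2 as [E2|E2]; [lra|].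
  rewrite E1, E2 in S. lra.
Qed.

(* The least distance to the origin is invariant under rotations. *)
Lemma rolling_distinct (g r1 r2 : R -> R) (m1 M1 m2 M2 : R) (th : R) :
  radial_profile g r1 m1 M1 -> radial_profile g r2 m2 M2 ->
  (exists t, r1 t = m1) -> (exists t, r2 t = m2) ->
  (forall p, image (rolling_x g r1) (rolling_y g r1) p <->
             image (rolling_x g r2) (rolling_y g r2) (rot th p)) ->
  m1 = m2.
Proof.
intros [Hm1 [Hb1 _]] [Hm2 [Hb2 _]] [t1 E1] [t2 E2] Hi.
assert (Nrot : forall p, norm2 (rot th p) = norm2 p).
{ intros [a b]. unfold norm2, rot; simpl fst; simpl snd. f_equal.
  transitivity ((a ^ 2 + b ^ 2) * (Rsqr (sin th) + Rsqr (cos th))).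
  unfold Rsqr; ring. rewrite sin2_cos2; ring. }
assert (N1 : forall t, norm2 (rolling_x g r1 t, rolling_y g r1 t) = r1 t).
{ intros t; apply norm2_rolling. specialize (Hb1 t); lra. }
assert (N2 : forall t, norm2 (rolling_x g r2 t, rolling_y g r2 t) = r2 t).
{ intros t; apply norm2_rolling. specialize (Hb2 t); lra. }
apply Rle_antisym.
(* Rotate back the point of the second curve nearest to the origin; the first curve passes through
   the result. *)
- pose (p := rot (- th) (rolling_x g r2 t2, rolling_y g r2 t2)).
  assert (Ep : rot th p = (rolling_x g r2 t2, rolling_y g r2 t2)).
  { unfold p, rot; simpl fst; simpl snd. rewrite cos_neg, sin_neg.
    pose proof (sin2_cos2 th) as S. unfold Rsqr in S.
    set (u := rolling_x g r2 t2). set (v := rolling_y g r2 t2). f_equal.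
    transitivity (u * (sin th * sin th + cos th * cos th)). ring. rewrite S; ring.
    transitivity (v * (sin th * sin th + cos th * cos th)). ring. rewrite S; ring. }
  destruct (proj2 (Hi p)) as [t Et]. exists t2; exact Ep.
  specialize (Hb1 t). specialize (N1 t). rewrite <- Et, <- Nrot, Ep, N2 in N1. lra.
- destruct (proj1 (Hi (rolling_x g r1 t1, rolling_y g r1 t1))) as [t Et]. exists t1; reflexivity.
  specialize (Hb2 t). specialize (N2 t). rewrite <- Et, Nrot, N1 in N2. lra.
Qed.

(** * Radial profiles with prescribed perihelion *)

Lemma continuous_of_local_lipschitz (f : R -> R) (x K d : R) :
  0 < d -> (forall y, Rabs (y - x) < d -> Rabs (f y - f x) <= K * Rabs (y - x)) ->
  continuous f x.
Proof.
intros Hd HK. apply continuity_pt_filterlim. intros eps Heps.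
pose proof (Rle_abs K). pose proof (Rabs_pos K).
exists (Rmin d (eps / (Rabs K + 1))).
assert (0 < eps / (Rabs K + 1)) by (apply Rdiv_lt_0_compat; lra).
split. apply Rmin_pos; lra.
intros y [_ Hy]. simpl in *; unfold R_dist in *.
assert (Hd1 : Rabs (y - x) < d) by (eapply Rlt_le_trans; [exact Hy|apply Rmin_l]).
assert (Hd2 : Rabs (y - x) < eps / (Rabs K + 1)) by (eapply Rlt_le_trans; [exact Hy|apply Rmin_r]).
specialize (HK y Hd1). pose proof (Rabs_pos (y - x)).
apply Rmult_lt_compat_r with (r := Rabs K + 1) in Hd2; [|lra].
replace (eps / (Rabs K + 1) * (Rabs K + 1)) with eps in Hd2 by (field; lra).
nra.
Qed.

Definition potential (g : R -> R) (r : R) : R := RInt (fun s => s * g s) 0 r.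

(** The constants 4 and 1/2 give [s * g s >= s / 2 >= 2] beyond [r0], so that [s * g s - w >= 1] for
    every [w] in [-1, 1]. *)
Definition admissible (g g1 : R -> R) (r0 : R) : Prop :=
  4 <= r0 /\ (forall s, is_derive g s (g1 s)) /\ (forall s, continuous g1 s) /\
  (forall s, r0 <= s -> 1 / 2 <= g s).

Lemma weighted_derive (g g1 : R -> R) (r0 : R) : admissible g g1 r0 ->
  forall s, is_derive (fun s => s * g s) s (g s + s * g1 s) /\
    continuous (fun s => g s + s * g1 s) s.
Proof.
intros [_ [Hg [Hg1 _]]] s. split.
- auto_derive. eexists; apply Hg.
  rewrite (is_derive_unique (fun x : R => g x) _ _ (Hg s)). ring.
- apply (continuous_plus g (fun s => s * g1 s)).
  apply (ex_derive_continuous g); eexists; apply Hg.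
  apply (continuous_mult (fun s => s) g1). apply continuous_id. apply Hg1.
Qed.

Lemma potential_derive (g g1 : R -> R) (r0 : R) : admissible g g1 r0 ->
  forall r, is_derive (potential g) r (r * g r).
Proof.
intros Ha r.
assert (Hc : forall s, continuous (fun s => s * g s) s).
{ intros s. apply (ex_derive_continuous (fun s => s * g s)). eexists; apply (weighted_derive _ _ _ Ha). }
apply (is_derive_RInt (fun s => s * g s) _ 0).
- apply filter_forall. intros y. apply (@RInt_correct R_CompleteNormedModule).
  apply ex_RInt_continuous. intros; apply Hc.
- apply Hc.
Qed.

Lemma weighted_lower_bound (g g1 : R -> R) (r0 : R) : admissible g g1 r0 ->
  forall s, r0 <= s -> s / 2 <= s * g s.
Proof. intros [H4 [_ [_ H]]] s Hs. specialize (H s Hs). nra. Qed.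

(** The map sending [r] to [potential g r - r * w] has derivative [r * g r - w >= 1], hence expands
    distances. Existence, uniqueness and stability of the profile all rest on this. *)
Lemma potential_growth (g g1 : R -> R) (r0 : R) : admissible g g1 r0 ->
  forall w r r', -1 <= w <= 1 -> r0 <= r <= r' ->
  r' - r <= (potential g r' - r' * w) - (potential g r - r * w).
Proof.
intros Ha w r r' Hw Hr. pose proof (potential_derive _ _ _ Ha) as HG.
destruct (MVT_gen (potential g) r r' (fun r => r * g r)) as [c [Hc E]].
- intros; apply HG.
- intros z _. apply continuity_pt_filterlim, (ex_derive_continuous (potential g)).
  eexists; apply HG.
- rewrite Rmin_left, Rmax_right in Hc by lra.
  assert (c / 2 <= c * g c) by (apply (weighted_lower_bound _ _ _ Ha); lra).
  destruct Ha as [H4 _].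
  assert (2 * (r' - r) <= c * g c * (r' - r)) by (apply Rmult_le_compat_r; lra).
  nra.
Qed.

(* The constant of motion [potential g a + a] makes [a] the perihelion,
   reached for [w = -1]. *)
Definition solves_profile (g : R -> R) (r0 : R) (P : R -> R -> R) : Prop :=
  forall a w, r0 <= a -> -1 <= w <= 1 ->
    a <= P a w <= 3 * a /\
    potential g (P a w) = potential g a + a + P a w * w.

Lemma profile_exists (g g1 : R -> R) (r0 : R) : admissible g g1 r0 ->
  exists P : R -> R -> R, solves_profile g r0 P.
Proof.
intros Ha.
(* The range conditions sit under the existential so that choice applies to all pairs; outside the
   range 0 is a dummy value. *)
assert (Hex : forall p : R * R, exists r, r0 <= fst p -> -1 <= snd p <= 1 ->
   fst p <= r <= 3 * fst p /\
   potential g r = potential g (fst p) + fst p + r * snd p).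
{ intros [a w]; simpl.
  destruct (classic (r0 <= a /\ -1 <= w <= 1)) as [[H1 H2]|Hn]; [|exists 0; tauto].
  pose proof (potential_growth _ _ _ Ha w a (3 * a) H2) as Hgr.
  assert (H4 : 4 <= r0) by apply Ha.
  (* The level to reach lies [a * (1 + w) <= 2 * a] above the value at [a], and the map gains at
     least [2 * a] between [a] and [3 * a]. *)
  destruct (IVT_gen (fun r => potential g r - r * w) a (3 * a) (potential g a + a)) as [r [Hr E]].
  - intros x. apply continuity_pt_filterlim.
    apply (continuous_minus (potential g) (fun r => r * w)).
    apply (ex_derive_continuous (potential g)); eexists; apply (potential_derive _ _ _ Ha).
    apply (continuous_mult (fun r => r) (fun _ => w)). apply continuous_id. apply continuous_const.
  - specialize (Hgr ltac:(lra)).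
    assert (potential g a - a * w <= potential g a + a) by nra.
    assert (potential g a + a <= potential g (3 * a) - 3 * a * w) by nra.
    rewrite Rmin_left, Rmax_right by lra. lra.
  - rewrite Rmin_left, Rmax_right in Hr by lra. exists r. intros _ _. split; lra. }
destruct (functional_choice _ Hex) as [P HP].
exists (fun a w => P (a, w)). intros a w H1 H2. apply (HP (a, w)); auto.
Qed.

(** Freeze [w]: the values of the expanding map at [r] and [r'] differ by
    [(k - k') + r' * (w - w')]. With [k = k'] this gives continuity of the profile in the angle,
    with [w = w'] its dependence on the perihelion. *)
Lemma profile_variation (g g1 : R -> R) (r0 : R) : admissible g g1 r0 ->
  forall r r' w w' k k',
  potential g r = k + r * w -> potential g r' = k' + r' * w' ->
  r0 <= r -> r0 <= r' -> -1 <= w <= 1 ->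
  Rabs (r - r') <= Rabs (k - k') + r' * Rabs (w - w').
Proof.
intros Ha r r' w w' k k' E E' Hr Hr' Hw.
assert (Hd : Rabs (r - r') <= Rabs ((k - k') + r' * (w - w'))).
{ destruct (Rle_dec r r') as [h|h].
  - pose proof (potential_growth _ _ _ Ha w r r' Hw ltac:(lra)).
    rewrite (Rabs_left1 (r - r')) by lra. rewrite Rabs_left1 by nra. nra.
  - pose proof (potential_growth _ _ _ Ha w r' r Hw ltac:(lra)).
    rewrite (Rabs_pos_eq (r - r')) by lra. rewrite Rabs_pos_eq by nra. nra. }
eapply Rle_trans. exact Hd. eapply Rle_trans. apply Rabs_triang.
rewrite Rabs_mult, (Rabs_pos_eq r'). lra. destruct Ha; lra.
Qed.

Lemma sin_lipschitz (s t : R) : Rabs (sin s - sin t) <= Rabs (s - t).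
Proof.
rewrite <- (Rmult_1_l (Rabs (s - t))).
apply (lipschitz_of_derive_bounded sin cos (Rmin s t) (Rmax s t)).
intros; apply is_derive_sin. intros; apply Rabs_le, COS_bound.
split; [apply Rmin_l|apply Rmax_l]. split; [apply Rmin_r|apply Rmax_r].
Qed.

(** Since [a >= 4] the bound is at least 1; its growth with [a] is what drives the period angle to
    0. *)
Lemma denominator_lower_bound (g g1 : R -> R) (r0 : R) (P : R -> R -> R) :
  admissible g g1 r0 -> solves_profile g r0 P ->
  forall a, r0 <= a -> forall t, a / 2 - 1 <= denominator g (fun t => P a (sin t)) t.
Proof.
intros Ha HP a Hr t. unfold denominator.
destruct (HP a (sin t) Hr (SIN_bound t)) as [H1 _].
pose proof (weighted_lower_bound _ _ _ Ha (P a (sin t)) ltac:(lra)).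
pose proof (SIN_bound t). lra.
Qed.

Lemma profile_is_radial (g g1 : R -> R) (r0 : R) (P : R -> R -> R) :
  admissible g g1 r0 -> solves_profile g r0 P ->
  forall a, r0 <= a -> radial_profile g (fun t => P a (sin t)) a (3 * a).
Proof.
intros Ha HP a Hr. assert (H4 : 4 <= r0) by apply Ha.
assert (HD : forall t, 1 <= denominator g (fun t => P a (sin t)) t).
{ intros t. pose proof (denominator_lower_bound _ _ _ _ Ha HP a Hr t). lra. }
split; [lra|split; [|split; [exact HD|split]]].
- intros t. apply HP. exact Hr. apply SIN_bound.
- intros t. f_equal. rewrite sin_plus, cos_2PI, sin_2PI. ring.
- intros t. unfold denominator.
  apply (implicit_derive (potential g) (fun t => P a (sin t)) sin (potential g a + a)).
  + intros s. apply HP. exact Hr. apply SIN_bound.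
  + apply continuous_of_local_lipschitz with (3 * a) 1. lra.
    intros s _.
    destruct (HP a (sin s) Hr (SIN_bound s)) as [B1 E1].
    destruct (HP a (sin t) Hr (SIN_bound t)) as [B2 E2].
    pose proof (profile_variation _ _ _ Ha _ _ _ _ _ _ E1 E2 ltac:(lra) ltac:(lra) (SIN_bound s)) as V.
    rewrite Rminus_diag, Rabs_R0 in V.
    pose proof (sin_lipschitz s t). pose proof (Rabs_pos (sin s - sin t)).
    assert (P a (sin t) * Rabs (sin s - sin t) <= 3 * a * Rabs (s - t)) by (apply Rmult_le_compat; lra).
    lra.
  + apply (potential_derive _ _ _ Ha).
  + apply is_derive_sin.
  + specialize (HD t). unfold denominator in HD. lra.
Qed.

(** At angle [- PI / 2] the conservation law reads [potential g r + r = potential g a + a], and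
    expansion forces [r = a]. *)
Lemma profile_attains_min (g g1 : R -> R) (r0 : R) (P : R -> R -> R) :
  admissible g g1 r0 -> solves_profile g r0 P ->
  forall a, r0 <= a -> exists t, P a (sin t) = a.
Proof.
intros Ha HP a Hr. exists (- (PI / 2)).
destruct (HP a _ Hr (SIN_bound (- (PI / 2)))) as [B E].
set (w := sin (- (PI / 2))) in *.
assert (Hw : w = -1) by (unfold w; rewrite sin_neg, sin_PI2; lra).
assert (Hb : -1 <= w <= 1) by lra.
pose proof (potential_growth _ _ _ Ha w a (P a w) Hb (conj Hr (proj1 B))) as Hgr.
set (r := P a w) in *. rewrite Hw in E, Hgr. lra.
Qed.

(** * The polar angle per period as a function of the perihelion *)

Definition period_angle (g : R -> R) (P : R -> R -> R) (a : R) : R :=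
  polar_angle g (fun t => P a (sin t)) (2 * PI).

(** At a fixed angle [sin u] cancels in the difference of the two denominators, which is therefore a
    difference of values of [s * g s]. As both denominators are at least 1, the integrands differ by
    no more than that. *)
Lemma period_angle_lipschitz (g g1 : R -> R) (r0 : R) (P : R -> R -> R) :
  admissible g g1 r0 -> solves_profile g r0 P ->
  forall N, exists K, 0 <= K /\ forall a b, r0 <= a <= N -> r0 <= b <= N ->
    Rabs (period_angle g P a - period_angle g P b) <= K * Rabs (a - b).
Proof.
intros Ha HP N. assert (H4 : 4 <= r0) by apply Ha.
pose proof (weighted_derive _ _ _ Ha) as Hw.
destruct (lipschitz_on_segment (fun s => s * g s) (fun s => g s + s * g1 s) r0 (3 * N)
  (fun s => proj1 (Hw s)) (fun s => proj2 (Hw s))) as [K1 [HK1 L1]].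
destruct (lipschitz_on_segment (potential g) (fun s => s * g s) r0 N
  (potential_derive _ _ _ Ha)) as [K2 [HK2 L2]].
{ intros s. apply (ex_derive_continuous (fun s => s * g s)). eexists; apply Hw. }
pose proof PI_RGT_0.
(* [2 * PI] is the length of the interval, [K1] controls [s * g s] up to [3 * N], where the profiles
   live, and [K2 + 1] controls the constant of motion [potential g a + a]. *)
exists (2 * PI * (K1 * (K2 + 1))). split.
{ apply Rmult_le_pos; [lra|]. apply Rmult_le_pos; lra. }
intros a b Hra Hrb.
pose proof (profile_is_radial _ _ _ _ Ha HP a ltac:(lra)) as Pa.
pose proof (profile_is_radial _ _ _ _ Ha HP b ltac:(lra)) as Pb.
assert (Hg : forall s, is_derive g s (g1 s)) by apply Ha.
pose proof (angle_rate_continuous _ _ _ _ _ Hg Pa) as Ca.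
pose proof (angle_rate_continuous _ _ _ _ _ Hg Pb) as Cb.
unfold period_angle, polar_angle.
assert (Ea : ex_RInt (fun u => sin u / denominator g (fun t => P a (sin t)) u) 0 (2 * PI))
  by (apply (@ex_RInt_continuous R_CompleteNormedModule); intros; apply Ca).
assert (Eb : ex_RInt (fun u => sin u / denominator g (fun t => P b (sin t)) u) 0 (2 * PI))
  by (apply (@ex_RInt_continuous R_CompleteNormedModule); intros; apply Cb).
pose proof (RInt_minus _ _ _ _ Ea Eb) as E. unfold minus, plus, opp in E; simpl in E.
match type of E with _ = ?x + - ?y => change (x + - y) with (x - y) in E end.
rewrite <- E.
eapply Rle_trans.
apply (abs_RInt_le_const _ 0 (2 * PI) (K1 * (K2 + 1) * Rabs (a - b))).
- lra.
- apply (@ex_RInt_minus R_NormedModule); assumption.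
- intros u _.
  destruct (HP a (sin u) ltac:(lra) (SIN_bound u)) as [B1 E1].
  destruct (HP b (sin u) ltac:(lra) (SIN_bound u)) as [B2 E2].
  pose proof (profile_variation _ _ _ Ha _ _ _ _ _ _ E1 E2 ltac:(lra) ltac:(lra) (SIN_bound u)) as V.
  rewrite Rminus_diag, Rabs_R0, Rmult_0_r, Rplus_0_r in V.
  destruct Pa as [_ [_ [Da _]]]. destruct Pb as [_ [_ [Db _]]].
  specialize (Da u). specialize (Db u).
  assert (V2 : Rabs (potential g a + a - (potential g b + b)) <= (K2 + 1) * Rabs (a - b)).
  { replace (potential g a + a - (potential g b + b)) with
      ((potential g a - potential g b) + (a - b)) by ring.
    eapply Rle_trans. apply Rabs_triang. specialize (L2 a b Hra Hrb). lra. }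
  specialize (L1 (P a (sin u)) (P b (sin u)) ltac:(lra) ltac:(lra)).
  set (da := denominator g (fun t => P a (sin t)) u) in *.
  set (db := denominator g (fun t => P b (sin t)) u) in *.
  assert (Ed : P a (sin u) * g (P a (sin u)) - P b (sin u) * g (P b (sin u)) = da - db)
    by (unfold da, db, denominator; ring).
  rewrite Ed in L1.
  assert (Ef : sin u / da + - (sin u / db) = - (sin u * / da * / db) * (da - db)) by (field; lra).
  change (Rabs (sin u / da + - (sin u / db)) <= K1 * (K2 + 1) * Rabs (a - b)).
  rewrite Ef, Rabs_mult, Rabs_Ropp, !Rabs_mult, !Rabs_inv, (Rabs_pos_eq da), (Rabs_pos_eq db) by lra.
  assert (Ia : 0 < / da <= 1).
  { split. apply Rinv_0_lt_compat; lra. rewrite <- Rinv_1. apply Rinv_le_contravar; lra. }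
  assert (Ib : 0 < / db <= 1).
  { split. apply Rinv_0_lt_compat; lra. rewrite <- Rinv_1. apply Rinv_le_contravar; lra. }
  assert (Is : 0 <= Rabs (sin u) <= 1) by (split; [apply Rabs_pos|apply Rabs_le, SIN_bound]).
  assert (0 <= Rabs (sin u) * / da <= 1) by nra.
  assert (0 <= Rabs (sin u) * / da * / db <= 1) by nra.
  pose proof (Rabs_pos (da - db)).
  apply Rle_trans with (Rabs (da - db)). nra.
  apply Rle_trans with (1 := L1). rewrite Rmult_assoc.
  apply Rmult_le_compat_l. exact HK1. lra.
- lra.
Qed.

Lemma period_angle_vanishes (g g1 : R -> R) (r0 : R) (P : R -> R -> R) :
  admissible g g1 r0 -> solves_profile g r0 P ->
  forall eps, 0 < eps -> exists N, forall a, N <= a -> Rabs (period_angle g P a) < eps.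
Proof.
intros Ha HP eps Heps. assert (H4 : 4 <= r0) by apply Ha.
pose proof PI_RGT_0 as Hpi.
(* Beyond this point [a / 2 - 1 >= 1 + 2 * PI / eps], so [2 * PI / (a / 2 - 1)], which bounds the
   integral, is below [eps]. *)
exists (Rmax r0 (2 * (2 + 2 * PI / eps))). intros a Hm.
assert (Hr : r0 <= a) by (eapply Rle_trans; [apply Rmax_l|exact Hm]).
assert (Hb : 2 * (2 + 2 * PI / eps) <= a) by (eapply Rle_trans; [apply Rmax_r|exact Hm]).
pose proof (profile_is_radial _ _ _ _ Ha HP a Hr) as Pa.
assert (Hg : forall s, is_derive g s (g1 s)) by apply Ha.
pose proof (angle_rate_continuous _ _ _ _ _ Hg Pa) as Ca.
assert (Hp : 0 < 2 * PI / eps) by (apply Rdiv_lt_0_compat; lra).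
unfold period_angle, polar_angle.
eapply Rle_lt_trans.
apply (abs_RInt_le_const _ 0 (2 * PI) (/ (a / 2 - 1))).
- lra.
- apply (@ex_RInt_continuous R_CompleteNormedModule); intros; apply Ca.
- intros u _. pose proof (denominator_lower_bound _ _ _ _ Ha HP a Hr u) as D.
  set (da := denominator g (fun t => P a (sin t)) u) in *.
  unfold Rdiv. rewrite Rabs_mult, Rabs_inv, (Rabs_pos_eq da) by lra.
  assert (Rabs (sin u) <= 1) by (apply Rabs_le, SIN_bound).
  assert (/ da <= / (a / 2 - 1)) by (apply Rinv_le_contravar; lra).
  assert (0 < / da) by (apply Rinv_0_lt_compat; lra).
  fold (a / 2). nra.
- apply Rmult_lt_reg_r with (a / 2 - 1). lra.
  replace ((2 * PI - 0) * / (a / 2 - 1) * (a / 2 - 1)) with (2 * PI) by (field; lra).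
  assert (eps * (2 * PI / eps) = 2 * PI) by (field; lra).
  nra.
Qed.

(** [Rmax r0 a] extends the function by a constant to the left of [r0]; the intermediate value
    theorem is applied to functions continuous on the whole line. *)
Lemma period_angle_continuous (g g1 : R -> R) (r0 : R) (P : R -> R -> R) :
  admissible g g1 r0 -> solves_profile g r0 P ->
  forall a, continuous (fun a => period_angle g P (Rmax r0 a)) a.
Proof.
intros Ha HP a.
destruct (period_angle_lipschitz _ _ _ _ Ha HP (Rmax r0 (a + 1))) as [K [HK0 HK]].
apply continuous_of_local_lipschitz with K 1. lra.
intros b Hb. apply Rabs_lt_between in Hb.
eapply Rle_trans. apply HK.
split. apply Rmax_l. apply Rle_max_compat_l; lra.
split. apply Rmax_l. apply Rle_max_compat_l; lra.
apply Rmult_le_compat_l. exact HK0.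
unfold Rmax. destruct (Rle_dec r0 b), (Rle_dec r0 a);
  unfold Rabs; repeat destruct Rcase_abs; lra.
Qed.

(** * Perihelia whose period angle is commensurable with a full turn *)

(** By the intermediate value theorem [f] takes every value in [(0, f a0]] beyond [a0], in
    particular [2 * PI / q] for all [q] above [2 * PI / f a0]. Distinct [q] give distinct values,
    hence distinct points. *)
Lemma small_values_attained (f : R -> R) (a0 : R) :
  (forall x, continuous f x) ->
  (forall eps, 0 < eps -> exists N, forall a, N <= a -> Rabs (f a) < eps) ->
  0 < f a0 ->
  exists (a : nat -> R) (q : nat -> nat),
    (forall n, a0 <= a n /\ (0 < q n)%nat /\ INR (q n) * f (a n) = 2 * PI) /\
    (forall n m, n <> m -> a n <> a m).
Proof.
intros Hc Hv H0. pose proof PI_RGT_0 as Hpi.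
destruct (INR_archimed 1 (2 * PI / f a0) ltac:(lra)) as [q0 Hq0].
rewrite Rmult_1_r in Hq0.
assert (Hp : 0 < 2 * PI / f a0) by (apply Rdiv_lt_0_compat; lra).
assert (Hex : forall n, exists a, a0 <= a /\ INR (q0 + n) * f a = 2 * PI).
{ intros n.
  assert (Hn : 2 * PI / f a0 < INR (q0 + n)) by (rewrite plus_INR; pose proof (pos_INR n); lra).
  set (y := 2 * PI / INR (q0 + n)).
  assert (Hy : 0 < y) by (apply Rdiv_lt_0_compat; lra).
  assert (Hyf : y <= f a0).
  { apply Rmult_le_reg_r with (INR (q0 + n)). lra.
    unfold y. replace (2 * PI / INR (q0 + n) * INR (q0 + n)) with (f a0 * (2 * PI / f a0)) by (field; lra).
    apply Rmult_le_compat_l; lra. }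
  destruct (Hv y Hy) as [N HN].
  specialize (HN (Rmax a0 N) (Rmax_r _ _)). apply Rabs_lt_between in HN.
  destruct (IVT_gen f a0 (Rmax a0 N) y) as [a [Ia Ea]].
  - intros x. apply continuity_pt_filterlim, Hc.
  - set (b := Rmax a0 N) in *. rewrite Rmin_right, Rmax_left by lra. lra.
  - exists a. rewrite Rmin_left in Ia by apply Rmax_l. split. lra.
    rewrite Ea. unfold y. field. lra. }
destruct (functional_choice _ Hex) as [a Hs].
exists a, (fun n => (q0 + n)%nat). split.
- intros n. destruct (Hs n) as [H1 H2]. split; [|split]; auto.
  apply INR_lt. rewrite plus_INR. simpl. pose proof (pos_INR n). lra.
- intros n m Hnm E. destruct (Hs n) as [_ H1], (Hs m) as [_ H2]. rewrite E in H1.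
  apply Hnm. assert (f (a m) <> 0) by (intros Z; rewrite Z in H1; lra).
  assert (Hq : INR (q0 + n) = INR (q0 + m)) by (apply Rmult_eq_reg_r with (f (a m)); lra).
  apply INR_eq in Hq. lia.
Qed.

(* A continuous function with limit 0 either vanishes identically or takes all
   values [2 PI / q], or all values [- 2 PI / q], with [q] large. *)
Lemma rational_angles_attained (f : R -> R) (r0 : R) :
  (forall x, continuous f x) ->
  (forall eps, 0 < eps -> exists N, forall a, N <= a -> Rabs (f a) < eps) ->
  exists (a : nat -> R) (q : nat -> nat) (k : Z),
    (forall n, r0 <= a n /\ (0 < q n)%nat /\ INR (q n) * f (a n) = 2 * PI * IZR k) /\
    (forall n m, n <> m -> a n <> a m).
Proof.
intros Hc Hv.
destruct (classic (exists a0, r0 <= a0 /\ f a0 <> 0)) as [[a0 [Hr Hn]]|Hz].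
- destruct (Rlt_or_le 0 (f a0)) as [h|h].
  + destruct (small_values_attained f a0 Hc Hv h) as [a [q [H1 H2]]].
    exists a, q, 1%Z. split; auto. intros n. destruct (H1 n) as [? [? ?]].
    split; [lra|split; auto; lra].
  + destruct (small_values_attained (fun x => - f x) a0) as [a [q [H1 H2]]].
    * intros x. apply (continuous_opp f), Hc.
    * intros eps He. destruct (Hv eps He) as [N HN]. exists N. intros a Ha.
      rewrite Rabs_Ropp. auto.
    * lra.
    * exists a, q, (-1)%Z. split; auto. intros n. destruct (H1 n) as [? [? ?]].
      split; [lra|split; auto; lra].
(* If [f] vanishes on the half-line, every perihelion closes up after one period with [k = 0]. *)
- exists (fun n => r0 + INR n), (fun _ => 1%nat), 0%Z. split.
  + intros n. assert (Hr : r0 <= r0 + INR n) by (pose proof (pos_INR n); lra).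
    split; [auto|split; [lia|]].
    destruct (Req_dec (f (r0 + INR n)) 0) as [e|e]. rewrite e; simpl; ring.
    destruct Hz; eauto.
  + intros n m Hnm E. apply Hnm, INR_eq. lra.
Qed.

(** * Asymptotics of [h] and the final construction *)

(** In the two limit regimes [htil] eventually lies within 1 of [B]: for [s >= 1] the weight
    [Rpower s (beta - 1)] is at most 1 when [beta <= 1], and the factor [s] is at least 1 when
    [beta = 0]. *)
Lemma correction_bounded (htil : R -> R) (beta : R) :
  0 <= beta ->
  (1 < beta -> exists M, forall s, 0 < s -> Rabs (htil s) <= M) ->
  (0 < beta <= 1 -> exists B : R,
     is_lim (fun s => (htil s - B) / Rpower s (beta - 1)) p_infty 0) ->
  (beta = 0 -> exists B : R, is_lim (fun s => (htil s - B) * s) p_infty 0) ->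
  exists M s0, 1 <= s0 /\ forall s, s0 <= s -> Rabs (htil s) <= M.
Proof.
intros Hb H1 H2 H3.
assert (Hgo : forall B s, Rabs (htil s - B) <= 1 -> Rabs (htil s) <= Rabs B + 1).
{ intros B s Hd. replace (htil s) with (B + (htil s - B)) by ring.
  eapply Rle_trans. apply Rabs_triang. lra. }
destruct (Rlt_or_le 1 beta) as [h|h].
- destruct (H1 h) as [M HM]. exists M, 1. split. lra. intros; apply HM; lra.
- destruct (Rlt_or_le 0 beta) as [h0|h0].
  + destruct (H2 (conj h0 h)) as [B HB]. apply is_lim_spec in HB.
    destruct (HB (mkposreal 1 Rlt_0_1)) as [N HN]. simpl in HN.
    exists (Rabs B + 1), (Rmax 1 (N + 1)). split. apply Rmax_l.
    intros s Hs.
    assert (1 <= s) by (eapply Rle_trans; [apply Rmax_l|exact Hs]).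
    assert (N + 1 <= s) by (eapply Rle_trans; [apply Rmax_r|exact Hs]).
    apply Hgo. specialize (HN s ltac:(lra)).
    assert (Hp : 0 < Rpower s (beta - 1)) by apply exp_pos.
    assert (Hp1 : Rpower s (beta - 1) <= 1).
    { rewrite <- (Rpower_O s) at 2 by lra. apply Rle_Rpower; lra. }
    rewrite Rminus_0_r in HN. unfold Rdiv in HN.
    rewrite Rabs_mult, Rabs_inv, (Rabs_pos_eq (Rpower s (beta - 1))) in HN by lra.
    apply Rmult_lt_compat_r with (r := Rpower s (beta - 1)) in HN; [|exact Hp].
    rewrite Rmult_assoc, Rinv_l, Rmult_1_r in HN by lra. lra.
  + destruct (H3 ltac:(lra)) as [B HB]. apply is_lim_spec in HB.
    destruct (HB (mkposreal 1 Rlt_0_1)) as [N HN]. simpl in HN.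
    exists (Rabs B + 1), (Rmax 1 (N + 1)). split. apply Rmax_l.
    intros s Hs.
    assert (1 <= s) by (eapply Rle_trans; [apply Rmax_l|exact Hs]).
    assert (N + 1 <= s) by (eapply Rle_trans; [apply Rmax_r|exact Hs]).
    apply Hgo. specialize (HN s ltac:(lra)).
    rewrite Rminus_0_r, Rabs_mult, (Rabs_pos_eq s) in HN by lra.
    pose proof (Rabs_pos (htil s - B)). nra.
Qed.

Lemma curvature_lower_bound (h htil : R -> R) (A gamma beta M s1 : R) :
  1 < gamma -> 0 <= beta -> 1 <= s1 ->
  (forall s, s1 <= s -> Rabs (htil s) <= M) ->
  (exists s0, forall s, s0 <= s ->
     h s = 1 + A / Rpower s gamma + htil s / Rpower s (gamma + beta)) ->
  exists s0, forall s, s0 <= s -> 1 / 2 <= h s.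
Proof.
intros Hgam Hbet Hs1 HM [s0 Hh].
(* Both exponents are at least 1, so the two corrections lower [h s] by at most [(Rabs A + M) / s],
   which is at most 1/2 from here on. *)
exists (Rmax s0 (Rmax s1 (2 * (Rabs A + M)))). intros s Hs.
assert (s0 <= s) by (eapply Rle_trans; [apply Rmax_l|exact Hs]).
assert (Hs' : Rmax s1 (2 * (Rabs A + M)) <= s) by (eapply Rle_trans; [apply Rmax_r|exact Hs]).
assert (s1 <= s) by (eapply Rle_trans; [apply Rmax_l|exact Hs']).
assert (2 * (Rabs A + M) <= s) by (eapply Rle_trans; [apply Rmax_r|exact Hs']).
rewrite Hh by assumption.
assert (Hq : forall c e, 1 <= e -> - (Rabs c / s) <= c / Rpower s e).
{ intros c e He.
  assert (s <= Rpower s e) by (rewrite <- (Rpower_1 s) at 1 by lra; apply Rle_Rpower; lra).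
  assert (/ Rpower s e <= / s) by (apply Rinv_le_contravar; lra).
  assert (0 < / Rpower s e) by (apply Rinv_0_lt_compat; lra).
  pose proof (Rle_abs (- c)) as Hc. rewrite Rabs_Ropp in Hc. pose proof (Rabs_pos c).
  unfold Rdiv. nra. }
pose proof (Hq A gamma ltac:(lra)) as Q1.
pose proof (Hq (htil s) (gamma + beta) ltac:(lra)) as Q2.
specialize (HM s ltac:(lra)).
assert (Rabs A / s + Rabs (htil s) / s <= 1 / 2).
{ apply Rmult_le_reg_r with s. lra.
  replace ((Rabs A / s + Rabs (htil s) / s) * s) with (Rabs A + Rabs (htil s)) by (field; lra).
  lra. }
lra.
Qed.

Theorem theorem1p1p5
  (H : R * R -> R) (h : R -> R) (htil : R -> R) (A gamma beta C : R)
  (HC2 : C2_plane H)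
  (Hrad : forall p, H p = h (norm2 p))
  (HA : A <> 0) (Hgamma : 1 < gamma) (Hbeta : 0 <= beta)
  (Hexp : exists s0, forall s, s0 <= s ->
     h s = 1 + A / Rpower s gamma + htil s / Rpower s (gamma + beta))
  (Htil : C2_pos htil)
  (Hb1 : 1 < beta -> exists M, forall s, 0 < s -> Rabs (htil s) <= M)
  (Hb2 : 0 < beta <= 1 -> exists B : R,
     is_lim (fun s => (htil s - B) / Rpower s (beta - 1)) p_infty 0)
  (Hb3 : beta = 0 -> exists B : R, B <> - A /\
     is_lim (fun s => (htil s - B) * s) p_infty 0)
  (HCpos : 0 < C)
  (Hh2 : exists s0, forall s, s0 <= s ->
     Rabs (Derive_n h 2 s) <= C * Rpower s (- (gamma + 1 + Rmin 1 beta))) :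
  forall alpha, 0 < alpha < 1 ->
  exists (X Y : nat -> R -> R) (T : nat -> R),
    (forall n, closed_immersed_C2alpha alpha (X n) (Y n) (T n) /\
               forall t, curvature (X n) (Y n) t = H (X n t, Y n t)) /\
    (* the curves are pairwise geometrically distinct, even up to rotations
       about the origin (which preserve the radial H) *)
    (forall n m, n <> m -> ~ exists th, forall p,
        image (X n) (Y n) p <-> image (X m) (Y m) (rot th p)).
Proof.
intros alpha Halpha.
destruct HC2 as (H1 & H2 & H11 & H12 & H21 & H22 & D1 & _ & D11 & _ & _ & _ & Hc).
(* The conditions on [h] concern nonnegative radii; restricting [H] to the horizontal axis gives an
   even C2 function on the whole line that agrees with [h] there. *)
set (g := fun s => H (s, 0)). set (g1 := fun s => H1 (s, 0)). set (g2 := fun s => H11 (s, 0)).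
assert (Hg : forall s, is_derive g s (g1 s)) by (intros s; apply D1).
assert (Hg1 : forall s, is_derive g1 s (g2 s)) by (intros s; apply D11).
assert (Hg2 : forall s, continuous g2 s).
{ intros s. apply (continuous_comp_2 (fun s => s) (fun _ => 0) (fun a b => H11 (a, b))).
  apply continuous_id. apply continuous_const.
  apply continuous_ext with H11. intros [a b]; reflexivity. apply (Hc (s, 0)). }
assert (Hgh : forall s, 0 <= s -> g s = h s).
{ intros s Hs. unfold g. rewrite Hrad. f_equal. unfold norm2; simpl fst; simpl snd.
  replace (s ^ 2 + 0 ^ 2) with (s ^ 2) by ring. apply sqrt_pow2, Hs. }
destruct (correction_bounded htil beta Hbeta Hb1 Hb2) as [M [s1 [Hs1 HM]]].
{ intros e. destruct (Hb3 e) as [B [_ HB]]. eauto. }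
destruct (curvature_lower_bound h htil A gamma beta M s1 Hgamma Hbeta Hs1 HM Hexp) as [s2 Hs2].
set (r0 := Rmax 4 s2).
assert (Ha : admissible g g1 r0).
{ assert (4 <= r0) by apply Rmax_l. assert (s2 <= r0) by apply Rmax_r.
  split; [auto|split; [auto|split]].
  - intros s. apply (ex_derive_continuous g1). eexists; apply Hg1.
  - intros s Hs. rewrite Hgh by lra. apply Hs2; lra. }
destruct (profile_exists g g1 r0 Ha) as [P HP].
destruct (rational_angles_attained (fun a => period_angle g P (Rmax r0 a)) r0) as (a & q & k & Hq & Hinj).
{ apply (period_angle_continuous _ _ _ _ Ha HP). }
{ intros eps Heps. destruct (period_angle_vanishes _ _ _ _ Ha HP eps Heps) as [N HN].
  exists N. intros x Hx. apply HN. eapply Rle_trans. exact Hx. apply Rmax_r. }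
assert (Hr : forall n, radial_profile g (fun t => P (a n) (sin t)) (a n) (3 * a n)).
{ intros n. apply (profile_is_radial _ _ _ _ Ha HP). apply Hq. }
exists (fun n => rolling_x g (fun t => P (a n) (sin t))),
  (fun n => rolling_y g (fun t => P (a n) (sin t))), (fun n => INR (q n) * (2 * PI)).
split.
- intros n. destruct (Hq n) as [Hn [Hqn E]]. rewrite Rmax_right in E by exact Hn. split.
  + apply (rolling_closed g g1 g2 _ (a n) (3 * a n) alpha k (q n)); auto.
  + intros t. rewrite (rolling_curvature _ _ _ _ _ Hg (Hr n)).
    assert (Hpos : 0 <= P (a n) (sin t)) by (destruct (Hr n) as [? [B _]]; specialize (B t); simpl in B; lra).
    rewrite Hrad, norm2_rolling by exact Hpos. apply Hgh, Hpos.
(* The nth curve has least distance [a n] to the origin, so congruent curves would have equal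
   perihelia. *)
- intros n m Hnm [th Hth]. apply (Hinj n m Hnm).
  apply (rolling_distinct _ _ _ _ _ _ _ th (Hr n) (Hr m)); auto;
  apply (profile_attains_min _ _ _ _ Ha HP), Hq.
Qed.
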